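(* Let $q=2^m$ where $m\ge 4$ is even, and let $B=\{u\in\mathrm{GF}(q):\mathrm{Tr}(u^3)=1\}$. Let $\omega\in\mathrm{GF}(q)$ be a primitive cube root of unity ($\omega^3=1$, $\omega\neq 1$). Then the setwise stabiliser of $B$ in $\mathrm{GA}_1(q)=\{x\mapsto ax+b:a\in\mathrm{GF}(q)^*,b\in\mathrm{GF}(q)\}$ is $$G_B=\{x\mapsto \omega^k x+\delta\omega^j:\ k,j\in\{0,1,2\},\ \delta\in\{0,1\}\}.$$
   Context: $\mathrm{Tr}$ denotes the absolute trace from $\mathrm{GF}(2^m)$ to $\mathrm{GF}(2)$. *)

(* Defs.v *)
From HB Require Import structures.
From mathcomp Require Import all_boot all_order all_algebra all_fingroup.
From mathcomp Require Import all_solvable all_field.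

Set Implicit Arguments.
Unset Strict Implicit.
Unset Printing Implicit Defensive.

Import GRing.Theory.
Local Open Scope ring_scope.

Section Definitions.

Variable F : finFieldType.

(* The absolute trace GF(2^m) -> GF(2) when #|F| = 2 ^ m, as a sum of Frobenius
   conjugates. It is valued in F, with GF(2) identified with the prime subfield
   {0, 1} (abs_trace_GF2); it is the Galois trace of F over 'F_2
   (abs_trace_galTrace). *)
Definition abs_trace (m : nat) (u : F) : F := \sum_(i < m) u ^+ (2 ^ i).

Definition cubic_set (m : nat) : {set F} := [set u | abs_trace m (u ^+ 3) == 1].

(* Affine maps are represented as permutations of F, so that the setwise
   stabiliser of B in GA1 is 'N_GA1(B | 'P) for the natural action 'P. *)
Definition GA1 : {set {perm F}} :=
  [set s : {perm F} | [exists a : F, exists b : F,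
              (a != 0) && [forall x, s x == a * x + b]]].

Definition cubic_stab (w : F) : {set {perm F}} :=
  [set s : {perm F} | [exists k : 'I_3, exists j : 'I_3,
            exists d in [set (0 : F); 1],
              [forall x, s x == w ^+ k * x + d * w ^+ j]]].

End Definitions.

Arguments abs_trace {F} m u.
Arguments cubic_set F m : clear implicits.
Arguments GA1 F : clear implicits.
Arguments cubic_stab {F} w.

Lemma abs_trace_GF2 (F : finFieldType) (m : nat) (u : F) :
  #|F| = (2 ^ m)%N -> (abs_trace m u == 0) || (abs_trace m u == 1).
Proof.
move=> oF; have ch2 := card_finPcharP oF isT.
suff fixT: abs_trace m u ^+ 2 = abs_trace m u.
  rewrite -[abs_trace m u == 1]subr_eq0 -mulf_eq0.
  by rewrite mulrBr mulr1 -expr2 fixT subrr.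
rewrite -(pFrobenius_autE ch2) /abs_trace rmorph_sum /=.
under eq_bigr do rewrite pFrobenius_autE -exprM -expnSr.
case: m oF => [|m] oF; first by rewrite !big_ord0.
by rewrite big_ord_recr big_ord_recl /= -oF expf_card addrC expr1.
Qed.

Lemma abs_trace_galTrace (F : finFieldType) (m : nat)
    (ch2 : 2%N \in [pchar F]) (u : F) :
  #|F| = (2 ^ m)%N ->
  abs_trace m u = galTrace 1 {: pPrimeCharType ch2} (u : pPrimeCharType ch2).
Proof.
move=> oF; set L := pPrimeCharType ch2.
have dimL : \dim {:L} = m.
  by rewrite pprimeChar_dimf [X in logn _ X]oF pfactorK.
have [alpha genA alphaE] := finField_galois_generator (sub1v {:L}%AS).
have oG : #|'Gal({:L} / 1%AS)%g| = m.
  by rewrite -galois_dim ?finField_galois ?sub1v // dimv1 divn1 dimL.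
have alphaX i (x : L) : (alpha ^+ i)%g x = x ^+ (2 ^ i).
  elim: i => [|i IHi]; first by rewrite expg0 gal_id expr1.
  rewrite expgSr galM ?memvf // IHi alphaE ?memvf //.
  by rewrite dimv1 expn1 card_Fp // -exprM -expnSr.
rewrite /galTrace (eqP genA).
have oA : #[alpha]%g = m by rewrite /order -(eqP genA).
rewrite (reindex (fun i : 'I_m => (alpha ^+ i)%g)) /=; last first.
  have ltA x : (x \in <[alpha]>)%g -> exists i : 'I_m, x = (alpha ^+ i)%g.
    by case/cyclePmin=> i; rewrite oA => lt_im ->; exists (Ordinal lt_im).
  have injA : injective (fun i : 'I_m => (alpha ^+ i)%g).
    move=> i j /eqP; rewrite eq_expg_mod_order oA !modn_small // => /eqP.
    exact: val_inj.
  have m_gt0 : (0 < m)%N by rewrite -oA.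
  pose g x := odflt (Ordinal m_gt0) [pick i : 'I_m | x == (alpha ^+ i)%g].
  exists g => [i _ | x /ltA[i ->]]; rewrite /g; case: pickP => /= [j /eqP|].
  - by move/injA.
  - by move/(_ i); rewrite eqxx.
  - by move=> ->.
  - by move/(_ i); rewrite eqxx.
under [RHS]eq_bigl => i do rewrite mem_cycle.
by apply: eq_bigr => i _; rewrite alphaX.
Qed.

(* Main.v *)
Require Import Defs.
From mathcomp Require Import all_boot all_order all_algebra all_fingroup.
From mathcomp Require Import all_solvable all_field.
From mathcomp Require Import ring.
Local Open Scope ring_scope.

Import GRing.Theory.

(** Polarising [u |-> Tr (u ^ 3)] gives the alternating form
    [Tr (u ^ 2 v + u v ^ 2)].  If [x |-> a x + b] stabilises [B], this form is
    invariant under [u |-> a u], so with [c = a ^ 3 + 1] nondegeneracy of the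
    trace yields [c ^ 2 x ^ 4 + c x = 0] for all [x]; as [q > 4], [c = 0].
    The remaining terms then amount to [Tr ((b + b ^ 4) (a x) ^ 2) = 0] for all
    [x], i.e. [b ^ 4 = b]. *)

Lemma finField_poly_eq0 (F : finFieldType) (p : {poly F}) :
  (size p <= #|F|)%N -> (forall x, p.[x] = 0) -> p = 0.
Proof.
move=> szp p0; apply/eqP; apply: contraTT szp => pn0.
rewrite -ltnNge cardE; apply: max_poly_roots pn0 _ (enum_uniq _).
by apply/allP=> x _; apply/rootP.
Qed.

Section AbsTrace.

Context {F : finFieldType} {m : nat}.
Hypothesis oF : #|F| = (2 ^ m)%N.

Let ch2 : 2%N \in [pchar F] := card_finPcharP oF isT.

Let m_gt0 : (0 < m)%N.
Proof. by case: m oF (finNzRing_gt1 F) => // ->. Qed.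

Lemma abs_traceD (u v : F) :
  abs_trace m (u + v) = abs_trace m u + abs_trace m v.
Proof.
rewrite /abs_trace -big_split; apply: eq_bigr => i _ /=.
by apply: exprDn_pchar; rewrite pnatX pnatE // ch2.
Qed.

(** Squaring permutes the conjugates [u ^+ (2 ^ i)] cyclically, the last one wrapping around because
    [u ^+ #|F| = u]. *)
Lemma abs_trace_sqr (u : F) : abs_trace m (u ^+ 2) = abs_trace m u.
Proof.
rewrite /abs_trace; under eq_bigr do rewrite -exprM -expnS.
case: m oF m_gt0 => // n oFn _.
by rewrite big_ord_recr big_ord_recl /= -oFn expf_card addrC expr1.
Qed.

Lemma abs_trace1 : ~~ odd m -> abs_trace m (1 : F) = 0.
Proof.
move=> m_even; rewrite /abs_trace; under eq_bigr do rewrite expr1n.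
rewrite sumr_const card_ord -(even_halfK m_even) -mul2n mulrnA.
by rewrite (pcharf0 ch2) mul0rn.
Qed.

(** For nonzero [z] the products [z * x] exhaust [F], so the trace polynomial would vanish
    everywhere. Its degree is below [#|F|] and its coefficient at ['X] is 1, a contradiction. *)
Lemma abs_trace_nondegenerate (z : F) :
  (forall x, abs_trace m (z * x) = 0) -> z = 0.
Proof.
move=> Tz; apply/eqP/negPn/negP => zn0.
pose p : {poly F} := \sum_(i < m) 'X^(2 ^ i).
have p0 : p = 0.
  apply: finField_poly_eq0 => [|x].
    rewrite oF; apply: leq_trans (size_sum _ _ _) _.
    by apply/bigmax_leqP => i _; rewrite size_polyXn ltn_exp2l.
  rewrite horner_sum -[RHS](Tz (z^-1 * x)) mulVKf //.
  by apply: eq_bigr => i _; rewrite hornerXn.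
have /eqP := congr1 (fun r : {poly F} => r`_1) p0.
rewrite /p coef0 coef_sum (bigD1 (Ordinal m_gt0)) //= coefXn eqxx.
rewrite big1 ?addr0 ?oner_eq0 // => i; rewrite coefXn -val_eqE /= => i_neq0.
by rewrite -(expn0 2) eqn_exp2l // eq_sym (negPf i_neq0).
Qed.

(** Every element is a square: [x ^+ (2 ^ m.-1)] is a square root of [x]. *)
Lemma abs_trace_nondegenerate_sqr (z : F) :
  (forall x, abs_trace m (z * x ^+ 2) = 0) -> z = 0.
Proof.
move=> Tz; apply: abs_trace_nondegenerate => x.
have <- : (x ^+ (2 ^ m.-1)) ^+ 2 = x; last exact: Tz.
by rewrite -exprM -expnSr prednK // -oF expf_card.
Qed.

(** The trace takes only the values 0 and 1, so membership determines it. *)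
Lemma cubic_setP (u v : F) :
  (u \in cubic_set F m) = (v \in cubic_set F m)
  <-> abs_trace m (u ^+ 3) = abs_trace m (v ^+ 3).
Proof.
rewrite !inE; split=> [|->] //.
case/orP: (abs_trace_GF2 (u ^+ 3) oF) => /eqP->;
  case/orP: (abs_trace_GF2 (v ^+ 3) oF) => /eqP->;
  by rewrite ?eqxx // ?[1 == 0]eq_sym ?[0 == 1]eq_sym oner_eq0.
Qed.

(** Invariance of the trace under squaring replaces [u ^+ 2 * v] by [u ^+ 4 * v ^+ 2], which gathers
    the polar form into one coefficient of [v ^+ 2]. *)
Lemma abs_trace_cubeD (u v : F) :
  abs_trace m ((u + v) ^+ 3) =
  abs_trace m (u ^+ 3) + abs_trace m (v ^+ 3)
  + abs_trace m ((u ^+ 4 + u) * v ^+ 2).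
Proof.
have two0 : 1 + 1 = 0 :> F by rewrite (addrr_pchar2 ch2).
have -> : (u + v) ^+ 3 = u ^+ 3 + v ^+ 3 + (u ^+ 2 * v + u * v ^+ 2).
  (* The factor [1 + 1] is kept explicit to make this an identity in every commutative ring, as
     [ring] requires. *)
  have -> : (u + v) ^+ 3 = u ^+ 3 + v ^+ 3 + (u ^+ 2 * v + u * v ^+ 2)
              + (1 + 1) * (u ^+ 2 * v + u * v ^+ 2) by ring.
  by rewrite two0 mul0r addr0.
by rewrite mulrDl !abs_traceD -(abs_trace_sqr (u ^+ 2 * v)) exprMn -exprM.
Qed.

Lemma cubic_affine_invariantP (a b : F) : (4 <= m)%N -> ~~ odd m -> a != 0 ->
  (forall x, abs_trace m ((a * x + b) ^+ 3) = abs_trace m (x ^+ 3))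
  <-> a ^+ 3 = 1 /\ b ^+ 4 = b.
Proof.
move=> m_ge4 m_even an0.
have oppF (x : F) : - x = x by apply: oppr_pchar2.
have addFF (x : F) : x + x = 0 by apply: addrr_pchar2.
have T0 : abs_trace m (0 : F) = 0 by rewrite -(addFF 1) abs_traceD addFF.
split=> [inv | [a3 b4] x]; last first.
  rewrite addrC abs_trace_cubeD b4 addFF mul0r T0 addr0 exprMn a3 mul1r.
  have -> : abs_trace m (b ^+ 3) = 0; last by rewrite add0r.
  (* Either [b = 0] or [b ^+ 3 = 1]; in the second case the trace of 1 vanishes because [m] is
     even. *)
  have /eqP : b * (b ^+ 3 - 1) = 0 by rewrite mulrBr mulr1 -exprS b4 subrr.
  rewrite mulf_eq0 subr_eq0 => /orP[]/eqP->; first by rewrite expr0n.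
  exact: abs_trace1.
have Tb : abs_trace m (b ^+ 3) = 0.
  by have := inv 0; rewrite mulr0 add0r => ->; rewrite expr0n.
have inv1 x : abs_trace m ((a * x) ^+ 3)
    + abs_trace m ((b ^+ 4 + b) * (a * x) ^+ 2) = abs_trace m (x ^+ 3).
  by rewrite -[RHS]inv [a * x + b]addrC abs_trace_cubeD Tb add0r.
(* The extra term contributed by [b] is additive in [x], so it drops out on polarising [inv1]. *)
have lin x y : abs_trace m ((b ^+ 4 + b) * (a * (x + y)) ^+ 2)
    = abs_trace m ((b ^+ 4 + b) * (a * x) ^+ 2)
    + abs_trace m ((b ^+ 4 + b) * (a * y) ^+ 2).
  rewrite -abs_traceD -mulrDr [a * (x + y)]mulrDr; congr (abs_trace m (_ * _)).
  by apply: exprDn_pchar; rewrite pnatE // ch2.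
have polar x y : abs_trace m (((a * x) ^+ 4 + a * x) * (a * y) ^+ 2)
    = abs_trace m ((x ^+ 4 + x) * y ^+ 2).
  have := inv1 (x + y).
  rewrite lin mulrDr !abs_trace_cubeD -(inv1 x) -(inv1 y).
  by rewrite addrAC [X in X + _ = _]addrACA => /addrI.
have c0 x : (a ^+ 3 + 1) ^+ 2 * x ^+ 4 + (a ^+ 3 + 1) * x = 0.
  apply: abs_trace_nondegenerate_sqr => y.
  (* Zero is written as the sum of the two equal sides of [polar]; everything then adds up to a
     multiple of [1 + 1]. *)
  rewrite -[RHS](addFF (abs_trace m ((x ^+ 4 + x) * y ^+ 2))) -{1}polar.
  rewrite -abs_traceD; apply/eqP; rewrite -subr_eq0 oppF -abs_traceD.
  have -> : ((a ^+ 3 + 1) ^+ 2 * x ^+ 4 + (a ^+ 3 + 1) * x) * y ^+ 2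
      + (((a * x) ^+ 4 + a * x) * (a * y) ^+ 2 + (x ^+ 4 + x) * y ^+ 2)
    = (1 + 1) * ((a ^+ 6 + a ^+ 3 + 1) * x ^+ 4 * y ^+ 2
                 + (a ^+ 3 + 1) * x * y ^+ 2) by ring.
  by rewrite addFF mul0r T0.
have a3 : a ^+ 3 = 1.
  apply/eqP; rewrite -subr_eq0 oppF; apply/eqP.
  pose p : {poly F} := (a ^+ 3 + 1) ^+ 2 *: 'X^4 + (a ^+ 3 + 1) *: 'X.
  have p0 : p = 0.
    apply: finField_poly_eq0 => [|x].
      (* A polynomial of degree at most 4 has size at most 5, within the bound 16 given by
         [4 <= m]. *)
      apply: (@leq_trans (2 ^ 4)); last by rewrite oF leq_exp2l.
      apply: leq_trans (size_polyD _ _) _; rewrite geq_max.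
      by apply/andP; split; apply: leq_trans (size_scale_leq _ _) _;
        rewrite ?size_polyXn ?size_polyX.
    by rewrite hornerD !hornerZ hornerXn hornerX.
  have := congr1 (fun r : {poly F} => r`_1) p0.
  by rewrite coef0 coefD !coefZ coefXn coefX mulr0 add0r mulr1.
split=> //; apply/eqP; rewrite -subr_eq0 oppF; apply/eqP.
apply: abs_trace_nondegenerate_sqr => x.
apply: (addrI (abs_trace m (x ^+ 3))).
(* Substituting [a^-1 * x] clears [a] from the extra term, and the cubes agree since
   [a ^+ 3 = 1]. *)
have := inv1 (a^-1 * x); rewrite mulVKf // => ->.
by rewrite exprMn exprVn a3 invr1 mul1r addr0.
Qed.

End AbsTrace.

Theorem theorem16 (F : finFieldType) (m : nat) (w : F)
    (hF : #|F| = (2 ^ m)%N) (hm4 : (4 <= m)%N) (hmeven : ~~ odd m)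
    (hw3 : w ^+ 3 = 1) (hw1 : w != 1) :
  'N_(GA1 F)(cubic_set F m | 'P)%g = cubic_stab w.
Proof.
have prim_w : 3.-primitive_root w.
  (* The order of [w] divides 3, and order 1 would force [w = 1]. *)
  have [k prim_k k_dvd3] := prim_order_exists (isT : 0 < 3)%N hw3.
  case: k k_dvd3 prim_k => [|[|[|[|k]]]] //= _ /prim_expr_order.
  by rewrite expr1 => w1; rewrite w1 eqxx in hw1.
have wX3 i : (w ^+ i) ^+ 3 = 1 by rewrite exprAC hw3 expr1n.
have wX_neq0 i : w ^+ i != 0.
  by apply: contra_eq_neq (wX3 i) => ->; rewrite expr0n eq_sym oner_neq0.
have stabP (s : {perm F}) a b : a != 0 -> (forall x, s x = a * x + b) ->
    (s \in 'N(cubic_set F m | 'P))%g <-> a ^+ 3 = 1 /\ b ^+ 4 = b.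
  move=> an0 sE; rewrite -(cubic_affine_invariantP hF a b) //.
  split=> [/astabsP sB x | inv].
    by apply/(cubic_setP hF); rewrite -sE; apply: sB.
  by apply/astabsP=> x; apply/(cubic_setP hF); rewrite /= apermE sE.
apply/setP=> s; rewrite inE; apply/andP/idP.
  rewrite inE => -[/existsP[a /existsP[b /andP[an0 /forallP sE]]]].
  case/(stabP s a b an0 (fun x => eqP (sE x))) => a3 b4.
  have [k ak] := prim_rootP prim_w a3.
  rewrite inE; apply/existsP; exists k.
  have [b0 | bn0] := eqVneq b 0.
    (* With [d = 0] the exponent [j] is immaterial. *)
    apply/existsP; exists ord0; apply/existsP; exists 0.
    rewrite !inE eqxx; apply/forallP=> x.
    by rewrite mul0r -ak -b0.
  have b3 : b ^+ 3 = 1 by apply: (mulfI bn0); rewrite -exprS b4 mulr1.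
  have [j bj] := prim_rootP prim_w b3.
  apply/existsP; exists j; apply/existsP; exists 1.
  rewrite !inE eqxx orbT; apply/forallP=> x.
  by rewrite mul1r -ak -bj.
rewrite inE => /existsP[k /existsP[j /existsP[d /andP[d01 /forallP sE]]]].
split.
  rewrite inE; apply/existsP; exists (w ^+ k).
  by apply/existsP; exists (d * w ^+ j); rewrite wX_neq0; apply/forallP.
apply/(stabP s (w ^+ k) (d * w ^+ j) (wX_neq0 k) (fun x => eqP (sE x))).
split=> //; move: d01; rewrite !inE => /orP[]/eqP->.
  by rewrite mul0r expr0n.
by rewrite mul1r exprS wX3 mulr1.
Qed.
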